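(* If $G$ is a (finite, simple) bipartite graph without isolated vertices, then $\chi'_{sCF}(G)\leq 3$.
   Context: For a graph $H$ and a vertex $v$, let $E_H(v)$ be the set of edges of $H$ incident to $v$, and for a pair $u,v$ let $E_H[uv]=E_H(u)\cup E_H(v)$. Given a graph $G$ and an edge colouring $c$ (not necessarily proper) of some subgraph $H$ of $G$, an edge $e$ of $G$ is satisfied by $c$ if the multiset $\{c(e'): e'\in E_H[e]\}$ contains a colour occurring exactly once in it. The parameter $\chi'_{sCF}(G)$ is the least number of colours for which there exist a subgraph $H$ of $G$ and an edge colouring of $H$ with that many colours satisfying every edge of $G$. *)

(* Defs.v *)
From mathcomp Require Import all_boot.
Set Implicit Arguments.
Unset Strict Implicit.
Unset Printing Implicit Defensive.

Record sgraph := SGraph {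
  vertex : finType;
  adj : rel vertex;
  adj_sym : symmetric adj;
  adj_irrefl : irreflexive adj }.

Section Graph.
Variable G : sgraph.
Local Notation V := (vertex G).

Definition edges : {set {set V}} :=
  [set [set p.1; p.2] | p : V * V & adj p.1 p.2].

Definition no_isolated_vertex : Prop := forall x : V, exists y : V, adj x y.

Definition bipartite : Prop :=
  exists A : {set V}, forall x y : V, adj x y -> (x \in A) != (y \in A).

(* A candidate subgraph is a pair (vertex set, edge set). *)
Definition is_subgraph (H : {set V} * {set {set V}}) : bool :=
  (H.2 \subset edges) && [forall e in H.2, e \subset H.1].

Definition incident_edges (H : {set V} * {set {set V}}) (v : V) :
    {set {set V}} := [set e in H.2 | v \in e].

Definition pair_edges (H : {set V} * {set {set V}}) (u v : V) :
    {set {set V}} := incident_edges H u :|: incident_edges H v.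

Local Notation edge_of H := {e : {set V} | e \in H.2}.

(* Multisets of colours are represented by sequences, up to order. *)
Definition pair_colours (H : {set V} * {set {set V}}) (k : nat)
    (c : {ffun edge_of H -> 'I_k}) (u v : V) : seq 'I_k :=
  [seq c e | e : edge_of H in [pred e | sval e \in pair_edges H u v]].

Definition satisfied (H : {set V} * {set {set V}}) (k : nat)
    (c : {ffun edge_of H -> 'I_k}) (u v : V) : bool :=
  [exists a : 'I_k, count_mem a (pair_colours c u v) == 1].

Definition sCF_colourable (k : nat) : bool :=
  [exists H : {set V} * {set {set V}}, is_subgraph H &&
    [exists c : {ffun edge_of H -> 'I_k},
      [forall u : V, forall v : V, adj u v ==> satisfied c u v]]].

(* Colouring all edges of G with distinct colours satisfies every edge. *)
Lemma sCF_colourable_ex : exists k, sCF_colourable k.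
Proof.
pose H := ([set: V], edges).
exists #|{: edge_of H}|; apply/existsP; exists H; apply/andP; split.
  by rewrite /is_subgraph subxx; apply/forall_inP => e _; rewrite subsetT.
apply/existsP; exists [ffun e => enum_rank e].
apply/forallP => u; apply/forallP => v; apply/implyP => auv.
have eP : [set u; v] \in H.2 by apply/imsetP; exists (u, v); rewrite ?inE.
pose e0 : edge_of H := exist (fun e => e \in H.2) _ eP.
apply/existsP; exists (enum_rank e0).
rewrite /pair_colours count_uniq_mem.
  suff -> : enum_rank e0 \in
      [seq [ffun e => enum_rank e] e
        | e : edge_of H in [pred e | sval e \in pair_edges H u v]] by [].
  apply/imageP; exists e0; last by rewrite ffunE.
  by rewrite inE /= /pair_edges /incident_edges !inE /= eP !eqxx.
rewrite map_inj_uniq ?enum_uniq // => x y.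
by rewrite !ffunE => /enum_rank_inj.
Qed.

Definition chi_sCF : nat := ex_minn sCF_colourable_ex.

End Graph.

(* Main.v *)
(** Let [A], [B] be the two sides and let [S] be a minimal subset of [A] that
    dominates [B].  By minimality each [s] in [S] has a private neighbour [p s]
    in [B], whose only neighbour in [S] is [s].  Let [H] consist of one edge
    from each [b] in [B] to [S], and give one colour to the edges [s (p s)] and
    a second colour to the rest.  An edge [ab] with [a] outside [S] meets
    exactly one edge of [H].  An edge [sb] with [s] in [S] meets [s (p s)], and
    no other edge of the first colour: such an edge would be [t (p t)] with
    [t <> s], so [b = p t], which is not adjacent to [s].  Hence two colours
    suffice. *)
Require Import Defs.
From mathcomp Require Import all_boot.
Set Implicit Arguments.
Unset Strict Implicit.
Unset Printing Implicit Defensive.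

Section SubgraphColouring.
Variable G : sgraph.
Local Notation V := (vertex G).

Lemma satisfied_unique_colour (H : {set V} * {set {set V}}) (k : nat)
    (c : {ffun {e : {set V} | e \in H.2} -> 'I_k}) (u v : V) e0 :
  sval e0 \in pair_edges H u v ->
  (forall e, sval e \in pair_edges H u v -> c e = c e0 -> e = e0) ->
  satisfied c u v.
Proof.
move=> e0P uniq_e0; apply/existsP; exists (c e0).
rewrite /pair_colours /image_mem count_map.
rewrite (@eq_in_count _ _ (pred1 e0)).
  by rewrite count_uniq_mem ?enum_uniq // mem_enum inE e0P.
move=> e; rewrite mem_enum inE => eP /=.
by apply/eqP/eqP => [|->] //; exact: uniq_e0.
Qed.

(** Lets [col] be defined on all vertex sets, so that later arguments avoid the dependent type of
    edges of the subgraph; keeping every vertex makes the subgraph condition just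
    [E \subset edges G]. *)
Lemma sCF_colourable_edge_colouring (k : nat) (E : {set {set V}})
    (col : {set V} -> 'I_k) :
  E \subset edges G ->
  (forall u v, adj u v -> exists2 e0,
     e0 \in pair_edges ([set: V], E) u v &
     forall e, e \in pair_edges ([set: V], E) u v -> col e = col e0 -> e = e0) ->
  sCF_colourable G k.
Proof.
move=> sE uniq_col; apply/existsP; exists ([set: V], E); apply/andP; split.
  by rewrite /is_subgraph sE; apply/forall_inP => e _; rewrite subsetT.
apply/existsP; exists [ffun e => col (sval e)].
apply/forallP => u; apply/forallP => v; apply/implyP => /uniq_col [e0 e0P e0U].
have e0E : e0 \in ([set: V], E).2.
  by move: e0P; rewrite !inE => /orP [] /andP [].
apply: (@satisfied_unique_colour _ _ _ _ _ (exist _ e0 e0E)) => //.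
move=> e eP; rewrite !ffunE /= => /(e0U _ eP) ee0.
exact: val_inj.
Qed.

Lemma private_dominating_set (A : {set V}) :
  (forall x y : V, adj x y -> (x \in A) != (y \in A)) ->
  no_isolated_vertex G ->
  exists S : {set V}, exists f p : V -> V,
    [/\ S \subset A,
        forall b, b \notin A -> f b \in S /\ adj (f b) b &
        forall s, s \in S -> p s \notin A /\
          forall t, t \in S -> adj t (p s) -> t = s].
Proof.
move=> bipA noiso.
pose dom (S : {set V}) :=
  [forall b in ~: A, [exists s in S, adj s b]] && (S \subset A).
have domA : dom A.
  rewrite /dom subxx andbT; apply/forall_inP => b; rewrite inE => bA.
  have [y aby] := noiso b; apply/exists_inP; exists y; last by rewrite adj_sym.
  by move: (bipA _ _ aby); rewrite (negbTE bA); case: (y \in A).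
have [S /minsetP [/andP [/forall_inP domS sSA] minS] _] := minset_exists domA.
have /fin_all_exists [f fP] b :
    exists s, b \notin A -> s \in S /\ adj s b.
  (* For [b] in [A] the requirement is vacuous and [b] is a dummy value. *)
  case: (boolP (b \in A)) => bA; first by exists b.
  have /exists_inP [s sS asb] : [exists s in S, adj s b].
    by apply: domS; rewrite inE.
  by exists s.
have /fin_all_exists [p pP] s : exists b, s \in S ->
    b \notin A /\ forall t, t \in S -> adj t b -> t = s.
  case: (boolP (s \in S)) => sS; last by exists s.
  (* By minimality, deleting [s] leaves some [b] undominated, so only [s] can be a neighbour of [b]
     in [S]. *)
  have : ~~ dom (S :\ s).
    apply/negP => /minS /(_ (subsetDl _ _)) /setP /(_ s).
    by rewrite !inE eqxx sS.
  rewrite /dom (subset_trans (subsetDl _ _) sSA) andbT.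
  move=> /forall_inPn [b bA /exists_inPn nb]; exists b => _.
  split=> [|t tS atb]; first by move: bA; rewrite inE.
  by apply/eqP; apply: contraT => ts; rewrite -(negbTE (nb t _)) // !inE ts.
by exists S, f, p; split.
Qed.

Lemma bipartite_sCF_colourable2 :
  bipartite G -> no_isolated_vertex G -> sCF_colourable G 2.
Proof.
move=> [A bipA] noiso.
have [S [f [p [sSA fP pP]]]] := private_dominating_set bipA noiso.
have fA b : b \notin A -> f b \in A.
  by move=> /fP [fS _]; apply: (subsetP sSA).
(* Whatever choice [f] makes, privacy forces it at [p s]; hence [star (p s)] is the edge from [s] to
   [p s]. *)
have fp s : s \in S -> f (p s) = s.
  by move=> sS; have [pA pU] := pP s sS; have [] := fP _ pA; apply: pU.
pose star b := [set f b; b].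
have star_A a b : a \in A -> b \notin A -> a \in star b -> a = f b.
  by move=> aA bA; rewrite !inE => /orP [] /eqP // ab; rewrite -ab aA in bA.
have star_B b b' : b \notin A -> b' \notin A -> b \in star b' -> b = b'.
  by move=> bA /fA fA'; rewrite !inE => /orP [] /eqP // bf; rewrite bf fA' in bA.
have star_inj b b' : b \notin A -> b' \notin A -> star b = star b' -> b = b'.
  by move=> bA b'A eq_st; apply: star_B => //; rewrite -eq_st !inE eqxx orbT.
pose E := star @: ~: A.
have starE b : b \notin A -> star b \in E by move=> bA; rewrite imset_f ?inE.
pose col e : 'I_2 := if [exists s in S, e == star (p s)] then ord0 else ord_max.
apply: (@sCF_colourable_edge_colouring _ E col) => [|u v auv].
  apply/subsetP => e /imsetP [b]; rewrite inE => /fP [_ afb] ->.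
  by apply/imsetP; exists (f b, b); rewrite ?inE.
wlog uvA : u v auv / u \in A /\ v \notin A.
  move=> IH; have := bipA _ _ auv.
  have [uA|uA] := boolP (u \in A); have [vA|vA] := boolP (v \in A) => // _.
    exact: IH.
  by rewrite /pair_edges setUC; apply: IH; rewrite // adj_sym.
have [uA vA] := uvA.
(* An edge [star b] can contain [u] only as its end in [A] and [v] only as its end outside [A]. *)
have pairP e : e \in pair_edges ([set: V], E) u v ->
    exists2 b, b \notin A & e = star b /\ (u = f b \/ v = b).
  rewrite !inE /= => /orP [] /andP [/imsetP [b]]; rewrite inE => bA -> eb;
    exists b => //; split=> //.
    by left; apply: star_A.
  by right; apply: star_B.
case: (boolP (u \in S)) => uS; last first.
  (* Values of [f] outside [A] lie in [S], so no chosen edge contains [u], and [star v] is alone. *)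
  exists (star v); first by rewrite !inE starE //= eqxx !orbT.
  move=> e /pairP [b bA [-> [uf|->]]] // _.
  by have [] := fP b bA; rewrite -uf (negbTE uS).
have [puA puU] := pP u uS.
exists (star (p u)); first by rewrite !inE starE //= fp // eqxx.
have -> : col (star (p u)) = ord0.
  by rewrite /col; case: exists_inP => // -[]; exists u.
move=> e /pairP [b bA [-> ub]].
rewrite /col; case: exists_inP => // -[s sS /eqP eq_st] _.
have [psA psU] := pP s sS.
have bps : b = p s by apply: star_inj.
(* A competitor of the first colour is [star (p s)]; it contains [u] or equals [star v], and in the
   latter case [u] is adjacent to [p s]. *)
suff -> : u = s by [].
case: ub => [->|vb]; first by rewrite bps fp.
by apply: psU => //; rewrite -bps -vb.
Qed.

End SubgraphColouring.

Theorem theorem1 (G : sgraph) (hbip : bipartite G)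
  (hiso : no_isolated_vertex G) : chi_sCF G <= 3.
Proof.
rewrite /chi_sCF; case: ex_minnP => k _ /(_ 2 _) min_k.
by apply: leq_trans (min_k _) _ => //; apply: bipartite_sCF_colourable2.
Qed.
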